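(* For $m\ge1$ define the $m\times m$ tridiagonal matrix $$D_m(q)=\begin{pmatrix} d_2(q)&1&&&0\\ -c_3(q)&d_3(q)&1&&\\ &-c_4(q)&d_4(q)&\ddots&\\ &&\ddots&\ddots&1\\ 0&&&-c_{m+1}(q)&d_{m+1}(q) \end{pmatrix},$$ i.e. with diagonal entries $d_2(q),\dots,d_{m+1}(q)$, all superdiagonal entries equal to $1$, subdiagonal entry $-c_{i+1}(q)$ in row $i$ and column $i-1$ for $2\le i\le m$, and all other entries $0$; by convention $\det D_0(q)=1$. Then for all $n\ge1$, $$\beta_n(q)=q\,\det D_{n-1}(q).$$ Equivalently, for all $n\ge0$, $$\beta_n(q)=\frac{\det C_{n+1}(q)-\det C_n(q)}{q^{n+1}},$$ where $C_m(q)$ is the $m\times m$ tridiagonal matrix with diagonal entries $d_1(q),\dots,d_m(q)$, all superdiagonal entries equal to $1$, subdiagonal entry $-c_i(q)$ in row $i$ and column $i-1$ for $2\le i\le m$, and all other entries $0$ (with $\det C_0(q)=1$).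
   Context: For $n\ge1$, $d_n(q)=1+q-q^n$ and $c_n(q)=q^{2n-1}+q^n-q$. The polynomials $\alpha_n(q)=\widehat F^{(n)}_0(q)$ and $\beta_n(q)=\widehat F^{(n)}_1(q)$ ($n\ge0$) are defined by $\alpha_0=1$, $\beta_0=0$ and, for $n\ge1$, $$\alpha_n=\alpha_{n-1}+q^n\beta_{n-1},\qquad \beta_n=q^n\alpha_{n-1}+(1-q^n)\beta_{n-1}.$$ *)

(* Defs.v *)
From mathcomp Require Import all_boot all_order all_algebra.

Set Implicit Arguments.
Unset Strict Implicit.
Unset Printing Implicit Defensive.

Import GRing.Theory.
Local Open Scope ring_scope.

(* The indeterminate q is 'X in {poly int}. *)
Definition d (n : nat) : {poly int} := 1 + 'X - 'X^n.

(* Meaningful for n >= 1; the truncated exponent at n = 0 is never used. *)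
Definition c (n : nat) : {poly int} := 'X^(2 * n - 1) + 'X^n - 'X.

Fixpoint alpha (n : nat) : {poly int} :=
  if n is k.+1 then alpha k + 'X^(k.+1) * beta k else 1
with beta (n : nat) : {poly int} :=
  if n is k.+1 then 'X^(k.+1) * alpha k + (1 - 'X^(k.+1)) * beta k else 0.

(* Tridiagonal matrix with superdiagonal entries 1; rows are numbered from 0,
   and row i carries diag i on the diagonal and sub i just left of it. *)
Definition tridiag (R : pzRingType) (diag sub : nat -> R) (m : nat) : 'M[R]_m :=
  \matrix_(i < m, j < m)
    if i == j :> nat then diag i
    else if j == i.+1 :> nat then 1
    else if i == j.+1 :> nat then sub i
    else 0.

(* Row i here is row i + 1 in the usual numbering from 1, hence the shifts;
   the determinants of size 0 are 1 by det_mx00. *)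
Definition matC (m : nat) : 'M[{poly int}]_m :=
  tridiag (fun i => d i.+1) (fun i => - c i.+1) m.

Definition matD (m : nat) : 'M[{poly int}]_m :=
  tridiag (fun i => d i.+2) (fun i => - c i.+2) m.

(* Main.v *)
(* Both determinants are continuants, so expanding along the last row gives
   the three-term recurrence u (n + 2) = d (n + 2) * u (n + 1) + c (n + 2) * u n,
   up to a shift of the index. Eliminating alpha, respectively beta, from the
   defining system shows that beta and alpha both satisfy it, whence
   beta n = q * det D (n - 1) and alpha n = det C n; the second formula is then
   the defining recurrence of alpha. *)

Require Import Defs.
From mathcomp Require Import all_boot all_order all_algebra.
From mathcomp Require Import ring zify.
Import GRing.Theory.
Local Open Scope ring_scope.

Section Tridiagonal.

Variable R : comPzRingType.
Implicit Types diag sub : nat -> R.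

Lemma row'_col'_max_tridiag diag sub m :
  row' ord_max (col' ord_max (tridiag diag sub m.+1)) = tridiag diag sub m.
Proof. by apply/matrixP => i j; rewrite !mxE !lift_max. Qed.

Lemma det_tridiag1 diag sub : \det (tridiag diag sub 1) = diag 0%N.
Proof. by rewrite det_mx11 mxE. Qed.

Lemma det_tridiagSS diag sub m :
  \det (tridiag diag sub m.+2) =
    diag m.+1 * \det (tridiag diag sub m.+1)
    - sub m.+1 * \det (tridiag diag sub m).
Proof.
set A := tridiag diag sub m.+2.
pose k : 'I_m.+2 := widen_ord (leqnSn m.+1) ord_max.
pose B := row' ord_max (col' k A).
(* The last column of [B] keeps a single nonzero entry, the superdiagonal 1 in its bottom corner;
   expand along it. *)
have detB : \det B = \det (tridiag diag sub m).
  rewrite (expand_det_col B ord_max) big_ord_recr /= big1 ?add0r => [|i _].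
    have -> : B ord_max ord_max = 1.
      rewrite !mxE lift_max /= /bump leqnn add1n eqxx.
      by rewrite (ltn_eqF (ltnSn m)).
    rewrite mul1r /cofactor addnn -signr_odd odd_double mul1r.
    congr (\det _); apply/matrixP => i j; rewrite !mxE !lift_max /=.
    (* As [j < m], neither column deletion shifts the index. *)
    suff -> : bump m (bump m j) = j by [].
    by rewrite /bump; have := ltn_ord j; lia.
  rewrite !mxE lift_max /= /bump leqnn add1n.
  have im := ltn_ord i.
  rewrite ifF; last by lia.
  rewrite ifF; last by lia.
  by rewrite ifF ?mul0r //; lia.
rewrite (expand_det_row A ord_max) big_ord_recr big_ord_recr /= big1 => [|i _].
  rewrite add0r addrC; congr (_ + _).
    rewrite mxE eqxx /cofactor row'_col'_max_tridiag.
    by rewrite addnn -signr_odd odd_double mul1r.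
  rewrite mxE /= (gtn_eqF (ltnSn m)) eqxx (ltn_eqF (leqnSn m.+1)).
  rewrite /cofactor -/k -/B detB /= addSn addnn.
  by rewrite -signr_odd /= odd_double expr1 mulN1r mulrN.
rewrite mxE /=; have im := ltn_ord i.
rewrite ifF; last by lia.
rewrite ifF; last by lia.
by rewrite ifF ?mul0r //; lia.
Qed.

End Tridiagonal.

Lemma alphaS n : alpha n.+1 = alpha n + 'X^(n.+1) * beta n.
Proof. by []. Qed.

Lemma betaS n : beta n.+1 = 'X^(n.+1) * alpha n + (1 - 'X^(n.+1)) * beta n.
Proof. by []. Qed.

(** With ['X^(n.+1)] as an atom, both recurrences below become identities linear in [alpha n] and
    [beta n], within reach of [ring]. *)
Lemma c_SS n : c n.+2 = 'X * 'X^(n.+1) ^+ 2 + 'X * 'X^(n.+1) - 'X.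
Proof.
by rewrite /c -exprM -!exprS; congr (_ ^+ _ + _ - _); lia.
Qed.

Lemma alphaSS n : alpha n.+2 = d n.+2 * alpha n.+1 + c n.+2 * alpha n.
Proof.
rewrite c_SS /d (alphaS n.+1) betaS (alphaS n) (exprS _ n.+1).
ring.
Qed.

Lemma betaSS n : beta n.+2 = d n.+2 * beta n.+1 + c n.+2 * beta n.
Proof.
rewrite c_SS /d (betaS n.+1) alphaS (betaS n) (exprS _ n.+1).
ring.
Qed.

Lemma det_matC n : \det (matC n) = alpha n.
Proof.
(* The recurrence has order two, so the induction carries two consecutive values. *)
suff [] : \det (matC n) = alpha n /\ \det (matC n.+1) = alpha n.+1 by [].
elim: n => [|n [IHn IHn1]]; split=> //.
- by rewrite det_mx00.
- by rewrite det_tridiag1 /d /= expr1; ring.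
- by rewrite det_tridiagSS -!/(matC _) IHn IHn1 alphaSS mulNr opprK.
Qed.

Lemma mulX_det_matD n : 'X * \det (matD n) = beta n.+1.
Proof.
suff [] : 'X * \det (matD n) = beta n.+1 /\
          'X * \det (matD n.+1) = beta n.+2 by [].
elim: n => [|n [IHn IHn1]]; split=> //.
- by rewrite det_mx00 /= expr1; ring.
(* Since [beta 0 = 0], the [c 2] term vanishes and the continuant for [beta] starts at [d 2]. *)
- by rewrite det_tridiag1 betaSS /d /= expr1; ring.
- rewrite det_tridiagSS -!/(matD _) (betaSS n.+1) -IHn -IHn1.
  ring.
Qed.

Theorem proposition5 :
  (forall n : nat, (1 <= n)%N -> beta n = 'X * \det (matD (n - 1)%N)) /\
  (forall n : nat,
     tofrac (beta n) =
       tofrac (\det (matC n.+1) - \det (matC n)) / tofrac ('X^(n.+1) : {poly int})).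
Proof.
split=> [[//|n] _|n]; first by rewrite subn1 mulX_det_matD.
(* The difference of determinants is ['X^(n.+1) * beta n]; the nonzero power cancels in the fraction
   field. *)
rewrite !det_matC alphaS addrC addKr rmorphM /= mulrC mulKf //.
by rewrite tofrac_eq0 expf_neq0 ?polyX_eq0.
Qed.
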